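(* Let $(H_n)_{n\in\mathbb N}$ be a sequence of Hilbert spaces, and let $\boldsymbol y=(y_n)_{n\in\mathbb N}\in\times_{n\in\mathbb N}H_n$ be a $C_0$-sequence. For each $n\in\mathbb N$, let $\mathcal T_n=(T_n(t))_{t\ge0}\subset\mathcal L(H_n)$ be a semigroup such that $\bigotimes_{n\in\mathbb N}^{\boldsymbol y}\mathcal T_n\subset\mathcal L\bigl(\bigotimes_{n\in\mathbb N}^{\boldsymbol y}H_n\bigr)$ is a nonzero semigroup. Then the following holds. (i) If $\mathcal T_n$ is weakly measurable for each $n\in\mathbb N$, then $\bigotimes_{n\in\mathbb N}^{\boldsymbol y}\mathcal T_n$ is weakly measurable. (ii) If $\mathcal T_n$ is strongly continuous in $(0,\infty)$ for each $n\in\mathbb N$, then $\bigotimes_{n\in\mathbb N}^{\boldsymbol y}\mathcal T_n$ is strongly continuous in $(0,\infty)$.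
   Context: Hilbert spaces are complex; $\mathcal L(H)$ denotes the bounded operators on $H$. A semigroup is a family $\mathcal T=(T(t))_{t\ge0}\subset\mathcal L(H)$ with $T(0)=I$ and $T(s+t)=T(s)T(t)$ (no measurability or continuity assumed a priori). It is nonzero if $T(t)\ne0$ for some $t>0$; weakly measurable if $t\mapsto\langle T(t)h,g\rangle$ is Lebesgue measurable for all $h,g\in H$; strongly continuous in $(0,\infty)$ if $t\mapsto T(t)h$ is norm continuous on $(0,\infty)$ for every $h\in H$. Products: for $(z_n)\subset\mathbb C$, $\prod_nz_n$ converges unconditionally to $a\in\mathbb C$ if $\lim_{N\to\infty}\prod_{n=1}^Nz_{\sigma(n)}=a$ for every bijection $\sigma:\mathbb N\to\mathbb N$. $\prod_nz_n$ is quasi-convergent if $\prod_n|z_n|$ converges unconditionally to a finite value; its value is then the unconditional limit of $\prod_nz_n$ if it exists and $0$ otherwise. Tensor products: $(h_n)\in\times_nH_n$ is a $C$-sequence if $\prod_n\|h_n\|$ converges unconditionally to a finite value. For a $C$-sequence $(h_n)$ the elementary tensor $\bigotimes_nh_n$ is the functional $(f_n)\mapsto\prod_n\langle h_n,f_n\rangle$ (quasi-convergent product) on the set of $C$-sequences. The complete tensor product $\bigotimes_nH_n$ is the completion of the linear span of elementary tensors with inner product determined by $\langle\bigotimes_nh_n,\bigotimes_nf_n\rangle=\prod_n\langle h_n,f_n\rangle$. A $C$-sequence is a $C_0$-sequence if $\sum_n|1-\|h_n\||<\infty$; two $C_0$-sequences are equivalent if $\sum_n|1-\langle h_n,f_n\rangle|<\infty$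 (an equivalence relation). For a $C_0$-sequence $\boldsymbol y$, the incomplete tensor product $\bigotimes_n^{\boldsymbol y}H_n$ is the closed linear span in $\bigotimes_nH_n$ of the $\bigotimes_nh_n$ with $(h_n)$ a $C_0$-sequence equivalent to $\boldsymbol y$. For $A_n\in\mathcal L(H_n)$, $\bigotimes_n^{\boldsymbol y}A_n$ is well-defined (factorwise sense) if for every elementary tensor $\bigotimes_nh_n\in\bigotimes_n^{\boldsymbol y}H_n$, $\bigotimes_nA_nh_n$ is an elementary tensor in $\bigotimes_n^{\boldsymbol y}H_n$, and $\bigotimes_nh_n\mapsto\bigotimes_nA_nh_n$ extends linearly to a bounded operator on $\bigotimes_n^{\boldsymbol y}H_n$. $\bigotimes_n^{\boldsymbol y}\mathcal T_n:=(\bigotimes_n^{\boldsymbol y}T_n(t))_{t\ge0}$; saying it is a semigroup includes that these operators are well-defined for all $t\ge0$. *)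

(* Defs.v *)
From HB Require Import structures.
From mathcomp Require Import all_boot all_order all_algebra.
From mathcomp Require Import sesquilinear complex.
From mathcomp Require Import mathcomp_extra boolp classical_sets functions.
From mathcomp Require Import reals topology normedtype sequences measure.
From mathcomp Require Import lebesgue_stieltjes_measure lebesgue_measure.

Set Implicit Arguments.
Unset Strict Implicit.
Unset Printing Implicit Defensive.

Import Order.TTheory GRing.Theory Num.Theory.
Import numFieldNormedType.Exports.

Local Open Scope classical_set_scope.
Local Open Scope ring_scope.

(* The topology of R[i] is the one induced by the modulus. *)
HB.instance Definition _ (R : realType) :=
  PseudoPointedMetric.copy R[i] R[i]^o.
HB.instance Definition _ (R : realType) := NormedModule.copy R[i] R[i]^o.

(* The inner product is linear in its first argument and conjugate-linear in
   the second one; norms take their values in R[i]. *)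
Record hilbert (R : realType) := Hilbert {
  hsort :> completeNormedModType R[i] ;
  hdot : {dot hsort for Num.conj} ;
  hnormE : forall x : hsort, `|x| ^+ 2 = hdot x x }.
Arguments hdot {R h}.

Section ClosedSpan.
Context {R : realType}.

Definition lspan (V : lmodType R[i]) (E : set V) : set V :=
  [set v | exists2 s : seq (R[i] * V),
    (forall p, p \in s -> E p.2) & v = \sum_(p <- s) p.1 *: p.2].

Lemma lspanP (V : lmodType R[i]) (E : set V) (a : R[i]) (u v : V) :
  lspan E u -> lspan E v -> lspan E (a *: u + v).
Proof.
move=> [s sE ->] [t tE ->].
exists ([seq (a * p.1, p.2) | p <- s] ++ t).
  move=> p; rewrite mem_cat => /orP[/mapP[q /sE qE ->]//|]; exact: tE.
rewrite big_cat/= big_map/= scaler_sumr; congr (_ + _).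
by apply: eq_bigr => p _; rewrite scalerA.
Qed.

Lemma lspan0 (V : lmodType R[i]) (E : set V) : lspan E 0.
Proof. by exists [::] => //; rewrite big_nil. Qed.

Variables (K : hilbert R) (E : set K).

Definition cspan : set K := closure (lspan E).

Definition cspan_pred : {pred K} := fun x => `[< cspan x >].

Lemma cspanP (a : R[i]) (u v : K) : cspan u -> cspan v -> cspan (a *: u + v).
Proof.
move=> cu cv B nB.
have cont : (fun z : K * K => a *: z.1 + z.2) @ (nbhs u, nbhs v) -->
    a *: u + v.
  apply: cvgD; last exact: cvg_snd.
  by apply: cvgZr; exact: cvg_fst.
have [[A1 A2] /= [nA1 nA2] AB] := cont _ nB.
have [x [Ex A1x]] := cu _ nA1.
have [y [Ey A2y]] := cv _ nA2.
exists (a *: x + y); split; first exact: lspanP.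
exact: (AB (x, y)).
Qed.

Lemma cspan_submod_closed : submod_closed cspan_pred.
Proof.
split.
  by apply/asboolP; apply: subset_closure; exact: lspan0.
by move=> a u v /asboolP cu /asboolP cv; apply/asboolP; exact: cspanP.
Qed.

HB.instance Definition _ :=
  GRing.isSubmodClosed.Build R[i] K cspan_pred cspan_submod_closed.

Record cspan_space :=
  CSpan { cspan_val : K ; cspan_valP : cspan_val \in cspan_pred }.

HB.instance Definition _ := [isSub for cspan_val].
HB.instance Definition _ := [Choice of cspan_space by <:].
HB.instance Definition _ := [SubChoice_isSubLmodule of cspan_space by <:].

Lemma cspan_norm_normD (x y : cspan_space) :
  `|val (x + y)| <= `|val x| + `|val y|.
Proof. by rewrite raddfD/= ler_normD. Qed.

Lemma cspan_norm_normZ (l : R[i]) (x : cspan_space) :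
  `|val (l *: x)| = `|l| * `|val x|.
Proof. by rewrite linearZ/= normrZ. Qed.

Lemma cspan_norm_eq0 (x : cspan_space) : `|val x| = 0 -> x = 0.
Proof. by move=> /normr0_eq0 x0; apply: val_inj; rewrite raddf0. Qed.

HB.instance Definition _ := @Lmodule_isNormed.Build R[i] cspan_space
  (fun x => `|val x|) cspan_norm_normD cspan_norm_normZ cspan_norm_eq0.

Lemma cspan_normE (x : cspan_space) : `|x| = `|val x|.
Proof. by []. Qed.

Lemma cspan_complete (F : set_system cspan_space) :
  ProperFilter F -> cauchy F -> cvg F.
Proof.
move=> FF /cauchy_ballP Fc.
have Gc : cauchy (val @ F).
  apply/cauchy_ballP => e e0.
  have [[A B] /= [FA FB] AB] := Fc e e0.
  exists (val @` A, val @` B).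
    by split; [apply: filterS FA|apply: filterS FB] => x Ax; exists x.
  move=> [_ _] /= [[x Ax <-] [y By <-]].
  have := AB (x, y) (conj Ax By).
  by rewrite -!ball_normE /= cspan_normE raddfB.
have [l Gl] := (cvg_ex _).1 (cauchy_cvg _ Gc).
have cl : l \in cspan_pred.
  apply/asboolP; apply: (@closed_closure _ (lspan E)).
  move=> B nB.
  have /filter_ex[x Bx] : F (val @^-1` B) := Gl _ nB.
  by exists (val x); split => //; have /asboolP := cspan_valP x.
apply/cvg_ex; exists (CSpan cl); apply/cvgrPdist_lt => e e0.
have /cvgrPdist_lt/(_ e e0) := Gl.
by apply: filterS => x; rewrite cspan_normE raddfB.
Qed.

HB.instance Definition _ :=
  Uniform_isComplete.Build cspan_space cspan_complete.

Definition cspan_dot (x y : cspan_space) : R[i] := hdot (val x) (val y).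

Lemma cspan_dot_bilinear :
  bilinear_for *%R (Num.conj \; *%R) cspan_dot.
Proof.
split => [u|u] a x y; rewrite /cspan_dot [val (_ + _)]linearP.
  by rewrite linearPl.
by rewrite linearPr.
Qed.

HB.instance Definition _ := bilinear_isBilinear.Build R[i]
  cspan_space cspan_space R[i] *%R (Num.conj \; *%R) cspan_dot
  cspan_dot_bilinear.

Lemma cspan_dot_herm (x y : cspan_space) :
  cspan_dot x y = (-1) ^+ false * Num.conj (cspan_dot y x).
Proof. by rewrite /cspan_dot hermC. Qed.

HB.instance Definition _ := isHermitianSesquilinear.Build R[i] cspan_space
  false Num.conj cspan_dot cspan_dot_herm.

Lemma cspan_dot_gt0 (x : cspan_space) : x != 0 -> 0 < cspan_dot x x.
Proof.
move=> x0; apply: neq0_dnorm_gt0; apply: contra x0 => /eqP x0.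
by apply/eqP/val_inj; rewrite raddf0.
Qed.

HB.instance Definition _ :=
  isDotProduct.Build R[i] cspan_space cspan_dot cspan_dot_gt0.

Lemma cspan_dot_normE (x : cspan_space) : `|x| ^+ 2 = cspan_dot x x.
Proof. by rewrite cspan_normE hnormE. Qed.

(* The closed linear span of E, as a Hilbert space. *)
Definition cspan_hilbert : hilbert R :=
  @Hilbert R cspan_space cspan_dot cspan_dot_normE.

End ClosedSpan.

Section Semigroups.
Context {R : realType}.
Implicit Types H : hilbert R.

Record bounded_op (H : hilbert R) := BoundedOp {
  bop_fun :> {linear H -> H} ;
  bop_bounded : exists M : R, forall x, `|bop_fun x| <= M%:C%C * `|x| }.

(* The values at negative times are irrelevant throughout. *)
Definition semigroup H (T : R -> bounded_op H) : Prop :=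
  (forall x, T 0 x = x) /\
  (forall s t, 0 <= s -> 0 <= t -> forall x, T (s + t) x = T s (T t x)).

Definition nonzero_semigroup H (T : R -> bounded_op H) : Prop :=
  exists2 t, 0 < t & exists x, T t x != 0.

(* R with the Lebesgue sigma-algebra, i.e., the Caratheodory-measurable sets of
   the outer Lebesgue measure. *)
Definition lebesgueR := caratheodory_type ((wlength (@idfun R))^*)%mu.

Definition borelC := g_sigma_algebraType (@open R[i]).

Definition weakly_measurable H (T : R -> bounded_op H) : Prop :=
  forall h g : H, @measurable_fun _ _ lebesgueR borelC
    [set t : R | 0 <= t] (fun t => hdot (T t h) g).

Definition strongly_continuous H (T : R -> bounded_op H) : Prop :=
  forall h : H, {within [set t : R | 0 < t], continuous (fun t => T t h)}.

End Semigroups.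

Section Products.
Context {R : realType}.
Implicit Types z : nat -> R[i].

Definition ucvg_prod z (a : R[i]) : Prop :=
  forall s : nat -> nat, bijective s ->
    (\prod_(n < N) z (s n)) @[N --> \oo] --> a.

(* The value of a quasi-convergent product; it is only used for products of
   inner products of C-sequences, which are quasi-convergent. *)
Definition qprod z : R[i] := xget 0 [set a | ucvg_prod z a].

End Products.

Section TensorProducts.
Context {R : realType}.
Variable H : nat -> hilbert R.

Definition is_cseq (h : forall n, H n) : Prop :=
  exists a, ucvg_prod (fun n => `|h n|) a.

Record cseq := CSeq { cseq_fun :> forall n, H n ; cseqP : is_cseq cseq_fun }.

Definition is_c0seq (h : cseq) : Prop :=
  cvgn (series (fun n => `|1 - `|h n| | : R[i])).

Definition c0equiv (h f : cseq) : Prop :=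
  cvgn (series (fun n => `|1 - hdot (h n) (f n)| : R[i])).

Definition elem_tensor (h : cseq) : cseq -> R[i] :=
  fun f => qprod (fun n => hdot (h n) (f n)).

(* The complete tensor product, given as a Hilbert space together with an
   embedding of the span of the elementary tensors (a space of functionals on
   the C-sequences) which makes it a completion of that span for the inner
   product determined by <(x)h_n, (x)f_n> = prod <h_n, f_n>. The embedding is
   irrelevant outside of the span. *)
Record complete_tensor := CompleteTensor {
  ct_space :> hilbert R ;
  ct_emb : (cseq -> R[i]) -> ct_space ;
  ct_emb_linear : forall (a : R[i]) (u v : cseq -> R[i]),
    lspan (range elem_tensor) u -> lspan (range elem_tensor) v ->
    ct_emb (a *: u + v) = a *: ct_emb u + ct_emb v ;
  ct_emb_dot : forall h f : cseq,
    hdot (ct_emb (elem_tensor h)) (ct_emb (elem_tensor f)) =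
    qprod (fun n => hdot (h n) (f n)) ;
  ct_emb_dense : closure (ct_emb @` lspan (range elem_tensor)) = setT }.

Variable K : complete_tensor.

Definition tensor (h : cseq) : K := ct_emb K (elem_tensor h).

Definition incomplete_tensor (y : cseq) : hilbert R :=
  cspan_hilbert [set tensor h | h in [set h | is_c0seq h /\ c0equiv h y]].

(* B is the factorwise tensor product of the A n: for every elementary tensor
   (x)h_n in the incomplete tensor product, (A_n h_n) is again a C-sequence and
   B maps (x)h_n to (x)A_n h_n. *)
Definition is_tensor_op (y : cseq) (A : forall n, bounded_op (H n))
    (B : bounded_op (incomplete_tensor y)) : Prop :=
  forall (h : cseq) (x : incomplete_tensor y), val x = tensor h ->
    exists2 Ah : cseq, (forall n, Ah n = A n (h n)) & val (B x) = tensor Ah.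

End TensorProducts.

(* Main.v *)
Require Import Defs.
From mathcomp Require Import all_boot all_order all_algebra.
From mathcomp Require Import lra sesquilinear complex.
From mathcomp Require Import mathcomp_extra boolp classical_sets functions.
From mathcomp Require Import interval_inference reals topology normedtype.
From mathcomp Require Import sequences measure measurable_realfun.
From mathcomp Require Import lebesgue_stieltjes_measure lebesgue_measure.
Set Implicit Arguments.
Unset Strict Implicit.
Unset Printing Implicit Defensive.
Import Order.TTheory GRing.Theory Num.Theory.
Import numFieldNormedType.Exports.
Local Open Scope classical_set_scope.
Local Open Scope ring_scope.

(** Let h be a C-sequence whose tensor lies in the incomplete tensor product
determined by y. Each T t maps it to the tensor of f = (T_n(t) h_n), and the
proof rests on one property of such tensors ([tensor_splice_cvg]): if the
entries of f from index N on are replaced by those of y, the resulting tensors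
converge in norm to the tensor of f as N grows. When the tensor of f is zero,
their norms tend to zero. Otherwise some g equivalent to y has a tensor that
is not orthogonal to that of f, so the product of the <f_n, g_n> converges
unconditionally to a nonzero value; inner products between the sequences that
start like f and continue like f, g or y are then a common head product times
tail products tending to 1, whence all of them approach each other
([splice_close]).

Consequently the orbit of an elementary tensor is the pointwise norm limit of
functions of t that involve only finitely many of the T_n, and these functions
are as regular as the T_n themselves.

(i) Weak measurability survives finite products and pointwise limits, which
gives it for pairs of elementary tensors; linear combinations and norm limits
([cspan_ind]) give it for all pairs of vectors.

(ii) The orbit is a pointwise limit of continuous functions on the positive
half-line, that is, a function of Baire class one, so its points of continuity
are dense ([baire_one_continuity]). The semigroup law carries continuity at a
time to all later times, so there is continuity everywhere
([orbit_continuous]). Linear combinations are immediate, and if orbits of u_k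
are continuous and u_k tends to u, then the orbit of u is again of Baire class
one, so that the same argument applies to it. *)

(** * Complex-valued limits *)

Section Complex.
Context {R : realType}.
Implicit Types (z w : nat -> R[i]).

Lemma normc_i : `|'i%C| = 1 :> R[i].
Proof. by rewrite normc_def /= expr0n expr1n add0r sqrtr1. Qed.

Lemma normc_ge_Im (x : R[i]) : `|complex.Im x|%:C%C <= `|x|.
Proof.
rewrite -[`|x|]mulr1 -normc_i -normrM -[X in X <= _]/(`|_|%:C%C) -normrN -ReiNIm.
exact: normc_ge_Re.
Qed.

Lemma normc_le_ReIm (x : R[i]) :
  `|x| <= (`|complex.Re x| + `|complex.Im x|)%:C%C.
Proof.
have nE (r : R) : `|r%:C%C| = `|r|%:C%C :> R[i].
  by rewrite normc_def /= expr0n addr0 sqrtr_sqr.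
rewrite [in X in `|X|](complexE x) (le_trans (ler_normD _ _))//.
by rewrite normrM normc_i mul1r !nE raddfD.
Qed.

Lemma complex_pos (e : R[i]) : 0 < e -> exists2 r : R, 0 < r & e = r%:C%C.
Proof.
move=> e0; have eE : (complex.Re e)%:C%C = e by rewrite RRe_real ?gtr0_real.
by exists (complex.Re e) => //; rewrite -ltcR eE.
Qed.

Section Cvg.
Context {T : Type} (F : set_system T) {FF : Filter F}.
Implicit Types f : T -> R[i].

Lemma cvg_Re f (a : R[i]) : f x @[x --> F] --> a ->
  complex.Re (f x) @[x --> F] --> complex.Re a.
Proof.
move=> /cvgrPdist_lt fa; apply/cvgrPdist_lt => e e0.
have /fa : (0 : R[i]) < e%:C%C by rewrite ltcR.
apply: filterS => n; rewrite -ltcR; apply: le_lt_trans.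
by rewrite -raddfB; exact: normc_ge_Re.
Qed.

Lemma cvg_Im f (a : R[i]) : f x @[x --> F] --> a ->
  complex.Im (f x) @[x --> F] --> complex.Im a.
Proof.
move=> /cvgrPdist_lt fa; apply/cvgrPdist_lt => e e0.
have /fa : (0 : R[i]) < e%:C%C by rewrite ltcR.
apply: filterS => n; rewrite -ltcR; apply: le_lt_trans.
by rewrite -raddfB; exact: normc_ge_Im.
Qed.

Lemma cvg_ReIm f (a : R[i]) :
  complex.Re (f x) @[x --> F] --> complex.Re a ->
  complex.Im (f x) @[x --> F] --> complex.Im a ->
  f x @[x --> F] --> a.
Proof.
move=> /cvgrPdist_lt fr /cvgrPdist_lt fi; apply/cvgrPdist_lt => _ /complex_pos[e e0 ->].
have e20 : 0 < e / 2 by rewrite divr_gt0.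
near=> n.
have nr : `|complex.Re a - complex.Re (f n)| < e / 2 by near: n; exact: fr.
have ni : `|complex.Im a - complex.Im (f n)| < e / 2 by near: n; exact: fi.
rewrite (le_lt_trans (normc_le_ReIm _))// !raddfB.
by rewrite ltcR (splitr e) ltrD.
Unshelve. all: end_near. Qed.
End Cvg.

(** Completeness of the complex numbers along sequences, read off the real and
imaginary parts; the Cauchy condition is the one that infinite products
provide. *)
Lemma complex_cauchy_cvg z :
  (forall e : R, 0 < e -> exists N, forall n, (N <= n)%N -> `|z n - z N| <= e%:C%C) ->
  exists a : R[i], z n @[n --> \oo] --> a.
Proof.
move=> zc.
have cvgR (g : nat -> R) : (forall n m, (`|g n - g m|)%:C%C <= `|z n - z m|) ->
    exists a : R, g n @[n --> \oo] --> a.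
  move=> gz; suff gc : cauchy (g n @[n --> \oo]).
    by exists (lim (g n @[n --> \oo])); exact: cauchy_cvg.
  apply: cauchy_exP => e e0; have e20 : 0 < e / 2 by rewrite divr_gt0.
  have [N NP] := zc _ e20.
  exists (g N); exists N => // n /= Nn; rewrite -ball_normE /= distrC.
  rewrite -ltcR (le_lt_trans (gz _ _))// (le_lt_trans (NP _ Nn))//.
  by rewrite ltcR ltr_pdivrMr// ltr_pMr// ltr1n.
have [a za] := cvgR (fun n => complex.Re (z n))
  (fun n m => ltac:(rewrite -raddfB; exact: normc_ge_Re)).
have [b zb] := cvgR (fun n => complex.Im (z n))
  (fun n m => ltac:(rewrite -raddfB; exact: normc_ge_Im)).
by exists (a +i* b)%C; exact: cvg_ReIm.
Qed.

End Complex.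

(** The order of the complex numbers is partial, so bounds on norms are passed to
the limit through the real part of the norm. *)
Lemma cvg_dist_le (R : realType) (V : normedModType R[i]) (T : Type)
    (F : set_system T) {FF : ProperFilter F} (f : T -> V) (l b : V) (e : R) :
  f x @[x --> F] --> l -> (\forall x \near F, `|f x - b| <= e%:C%C) ->
  `|l - b| <= e%:C%C.
Proof.
move=> /cvgrPdist_le fl fe.
have lE : (complex.Re `|l - b|)%:C%C = `|l - b| by rewrite RRe_real ?normr_real.
rewrite -lE lecR; apply/ler_addgt0Pr => d d0.
have /fl fd : (0 : R[i]) < d%:C%C by rewrite ltcR.
have [x [xe xd]] := filter_ex (filterI fe fd).
rewrite -lecR lE rmorphD (le_trans (ler_distD (f x) _ _))// addrC.
exact: lerD.
Qed.

(** * Unconditionally convergent products *)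

(** Any rearrangement has used up all indices below N after finitely many steps;
this is what makes initial segments and rearrangements comparable. *)
Lemma filter_rearrangement (s : nat -> nat) N : bijective s ->
  exists M0, forall M, (M0 <= M)%N ->
    perm_eq [seq n <- map s (iota 0 M) | (n < N)%N] (iota 0 N).
Proof.
move=> sb; have [g sg gs] := sb; exists (\max_(n < N) (g n).+1)%N => M M0M.
apply: uniq_perm.
- by rewrite filter_uniq// map_inj_uniq ?iota_uniq//; exact: bij_inj.
- exact: iota_uniq.
move=> n; rewrite mem_filter mem_iota/= add0n; case: ltnP => //= nN.
apply/mapP; exists (g n); last by rewrite gs.
rewrite mem_iota/= add0n (leq_trans _ M0M)//.
exact: (@leq_bigmax _ (fun n : 'I_N => (g n).+1) (Ordinal nN)).
Qed.

Section UnconditionalProducts.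
Context {R : realType}.

Definition headseq N (z : nat -> R[i]) : nat -> R[i] :=
  fun n => if (n < N)%N then z n else 1.

Definition tailseq N (z : nat -> R[i]) : nat -> R[i] :=
  fun n => if (n < N)%N then 1 else z n.

Implicit Types (z w : nat -> R[i]) (a b : R[i]).

Lemma prod_ord_map (s : nat -> nat) z M :
  \prod_(n < M) z (s n) = \prod_(n <- map s (iota 0 M)) z n.
Proof. by rewrite big_map -(big_mkord xpredT (fun n => z (s n))) /index_iota subn0. Qed.

Lemma ucvg_lim z a : ucvg_prod z a -> \prod_(n < N) z n @[N --> \oo] --> a.
Proof. by move=> /(_ id); apply; exists id. Qed.

Lemma qprodE z a : ucvg_prod z a -> qprod z = a.
Proof.
move=> za; rewrite /qprod; case: xgetP => [b _ zb|/(_ a)//].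
by have := ucvg_lim za; have /cvg_unique := ucvg_lim zb; apply.
Qed.

Lemma ucvgM z w a b : ucvg_prod z a -> ucvg_prod w b ->
  ucvg_prod (fun n => z n * w n) (a * b).
Proof.
move=> za wb s sb; under eq_fun do rewrite big_split/=.
by apply: cvgM; [exact: za|exact: wb].
Qed.

Lemma ucvg_headseq N z : ucvg_prod (headseq N z) (\prod_(n < N) z n).
Proof.
move=> s /(filter_rearrangement N)[M0 M0P]; apply: cvg_near_cst.
exists M0 => // M /= M0M; apply/eqP; rewrite (prod_ord_map s).
rewrite -big_mkcond -big_filter (perm_big _ (M0P _ M0M))/=.
by rewrite -(big_mkord xpredT z) /index_iota subn0.
Qed.

(** A finite number of factors can be changed without affecting unconditional
convergence, because the product splits into a factor of finite support and a
tail. *)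
Lemma ucvg_splice N z w b : ucvg_prod (tailseq N w) b ->
  ucvg_prod (fun n => if (n < N)%N then z n else w n) (\prod_(n < N) z n * b).
Proof.
move=> wb; suff -> : (fun n => if (n < N)%N then z n else w n) =
    (fun n => headseq N z n * tailseq N w n).
  by apply: ucvgM; [exact: ucvg_headseq|exact: wb].
by apply/funext => n; rewrite /headseq /tailseq; case: ifP => _; rewrite ?mulr1 ?mul1r.
Qed.

Lemma ucvg_neq0 z a n : ucvg_prod z a -> a != 0 -> z n != 0.
Proof.
move=> /ucvg_lim za; apply: contraNneq => zn0; apply/eqP.
suff z0 : \prod_(n < N) z n @[N --> \oo] --> (0 : R[i]).
  by have /cvg_unique := za; apply.
apply: cvg_near_cst; exists n.+1 => // N /= nN.
by rewrite (bigD1 (Ordinal nN))//= zn0 mul0r.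
Qed.

(** For a sequence without zeros this means unconditional convergence to a nonzero
limit; in this form it also tolerates finitely many zero factors, which
C_0-sequences may have. *)
Definition tail_ucvg z : Prop := exists2 tau : nat -> R[i],
  (forall N, ucvg_prod (tailseq N z) (tau N)) &
  tau N @[N --> \oo] --> (1 : R[i]).

Lemma tail_ucvg_neq0 z a : ucvg_prod z a -> a != 0 -> tail_ucvg z.
Proof.
move=> za a0; exists (fun N => a / \prod_(n < N) z n) => [N|].
  have zn0 n : z n != 0 := ucvg_neq0 n za a0.
  suff -> : tailseq N z = fun n => z n * headseq N (fun n => (z n)^-1) n.
    by apply: ucvgM; [exact: za|rewrite -prodfV; exact: ucvg_headseq].
  by apply/funext => n; rewrite /headseq /tailseq; case: ifP => _; rewrite ?mulr1 ?mulfV.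
rewrite -[X in _ --> X](mulfV a0); apply: cvgM; first exact: cvg_cst.
exact: (cvgV a0 (ucvg_lim za)).
Qed.

Lemma tail_ucvgM z w : tail_ucvg z -> tail_ucvg w -> tail_ucvg (fun n => z n * w n).
Proof.
move=> [s zs s1] [t wt t1]; exists (fun N => s N * t N) => [N|].
  suff -> : tailseq N (fun n => z n * w n) =
      (fun n => tailseq N z n * tailseq N w n) by exact: ucvgM.
  by apply/funext => n; rewrite /tailseq; case: ifP; rewrite ?mulr1.
by rewrite -[X in _ --> X]mulr1; exact: cvgM.
Qed.

(** A Cauchy condition on products over finite index sets, insensitive to the
order of the factors and hence suited to rearrangements. *)
Definition small_tails z : Prop := forall e : R, 0 < e -> exists N, forall s : seq nat,
  uniq s -> all (leq N) s -> `|\prod_(n <- s) z n - 1| <= e%:C%C.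

(** Partial products stay bounded once the tails are close to 1. Hence, for N
large, the product of any rearrangement remains close to the initial product
of length N as soon as it contains it, so that all rearrangements share the
limit of the original order. *)
Lemma small_tails_ucvg z : small_tails z -> exists a, ucvg_prod z a.
Proof.
move=> zt.
have split_head (s : nat -> nat) N : bijective s -> exists M0, forall M, (M0 <= M)%N ->
    exists r, [/\ uniq r, all (leq N) r &
      \prod_(n < M) z (s n) = \prod_(n < N) z n * \prod_(n <- r) z n].
  move=> sb; have [M0 M0P] := filter_rearrangement N sb.
  exists M0 => M M0M; exists [seq n <- map s (iota 0 M) | ~~ (n < N)%N]; split.
  - by rewrite filter_uniq// map_inj_uniq ?iota_uniq//; exact: bij_inj.
  - by apply/allP => n; rewrite mem_filter -leqNgt => /andP[].
  rewrite (prod_ord_map s z) (bigID (fun n => n < N)%N)/=.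
  rewrite -[in LHS]big_filter (perm_big _ (M0P _ M0M))/=.
  rewrite -(big_mkord xpredT z) /index_iota subn0 -[X in _ * X = _]big_filter.
  by [].
have idb : bijective (id : nat -> nat) by exists id.
(* Tails beyond N1 are within 1 of 1, hence of modulus at most 2. *)
have [N1 N1P] := zt 1 ltr01.
pose C : R := complex.Re (`|\prod_(n < N1) z n| * 2).
have CE : C%:C%C = `|\prod_(n < N1) z n| * 2 :> R[i].
  by rewrite /C RRe_real// ger0_real// mulr_ge0.
have [M1 M1P] := split_head _ N1 idb.
have Cb M : (M1 <= M)%N -> `|\prod_(n < M) z n| <= C%:C%C.
  move=> /M1P[r [ru rN ->]]; rewrite normrM CE ler_wpM2l//.
  rewrite -(subrK 1 (\prod_(n <- r) _)) (le_trans (ler_normD _ _))//.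
  by rewrite normr1 -[2]/(1 + 1) lerD2r (le_trans (N1P _ ru rN)).
have C0 : 0 <= C by rewrite -lecR; apply: le_trans (Cb _ (leqnn _)); exact: normr_ge0.
have close e : 0 < e -> exists N, forall s : nat -> nat, bijective s -> exists M0, forall M,
    (M0 <= M)%N -> `|\prod_(n < M) z (s n) - \prod_(n < N) z n| <= e%:C%C.
  move=> e0; have C10 : 0 < C + 1 by rewrite ltr_wpDl.
  have [N2 N2P] := zt (e / (C + 1)) (divr_gt0 e0 C10).
  exists (maxn M1 N2) => s sb.
  have [M0 M0P] := split_head _ (maxn M1 N2) sb.
  exists M0 => M /M0P[r [ru rN ->]].
  rewrite -{2}[\prod_(n < maxn _ _) _]mulr1 -mulrBr normrM.
  apply: (@le_trans _ _ (C%:C%C * (e / (C + 1))%:C%C)).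
    apply: ler_pM => //; first by rewrite Cb// leq_maxl.
    by apply: N2P => //; apply: sub_all rN => n; exact/leq_trans/leq_maxr.
  rewrite -rmorphM lecR mulrCA; apply: ler_piMr; first exact: ltW.
  by rewrite ler_pdivrMr// mul1r lerDl.
have [a za] : exists a : R[i], \prod_(n < N) z n @[N --> \oo] --> a.
  apply: complex_cauchy_cvg => e e0; have e20 : 0 < e / 2 by rewrite divr_gt0.
  have [N /(_ id idb)[M0 M0P]] := close _ e20.
  exists M0 => M M0M.
  rewrite (le_trans (ler_distD (\prod_(n < N) z n) _ _))//.
  rewrite (splitr e) rmorphD lerD// ?M0P// distrC; exact: M0P.
exists a => s sb; apply/cvgrPdist_le => _ /complex_pos[e e0 ->].
have e20 : 0 < e / 2 by rewrite divr_gt0.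
have [N NP] := close _ e20.
have aN : `|a - \prod_(n < N) z n| <= (e / 2)%:C%C.
  have [M0 M0P] := NP id idb.
  apply: (cvg_dist_le za).
  by exists M0.
have [M0 M0P] := NP s sb; exists M0 => // M /= /M0P MP.
rewrite (le_trans (ler_distD (\prod_(n < N) z n) _ _))//.
by rewrite (splitr e) rmorphD lerD// distrC.
Qed.

(** With s the sum of the deviations |1 - z_n| over a finite set, the product over
that set differs from 1 by at most 2s as long as 2s <= 1: in an induction one
more factor adds |1 - z_n| times the modulus of the product, which is at most
1 + 2s <= 2. *)
Lemma summable_small_tails z : cvgn (series (fun n => `|1 - z n| : R[i])) ->
  small_tails z.
Proof.
move=> zs e e0.
have sumP d : 0 < d -> exists N, forall s : seq nat,
    uniq s -> all (leq N) s -> \sum_(n <- s) `|1 - z n| <= d%:C%C.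
  move=> d0; have [l /cvgrPdist_le Sl] := (cvg_ex _).1 zs.
  have /Sl[N _ NP] : (0 : R[i]) < (d / 2)%:C%C by rewrite ltcR divr_gt0.
  exists N => s su sN; pose M := (\max_(n <- s) n.+1)%N.
  have sM : {subset s <= index_iota N (N + M)}.
    move=> n ns; rewrite mem_index_iota (allP sN _ ns)/=.
    by rewrite (leq_trans _ (leq_addl _ _))//; exact: (@leq_bigmax_seq _ _ _ succn).
  have -> : \sum_(n <- s) `|1 - z n| =
      \sum_(n <- index_iota N (N + M) | n \in s) `|1 - z n|.
    rewrite -[RHS]big_filter; apply: perm_big; apply: uniq_perm => //.
      by rewrite filter_uniq// iota_uniq.
    by move=> n; rewrite mem_filter; case: (boolP (n \in s)) => // /sM ->.
  apply: (@le_trans _ _ (\sum_(N <= n < N + M) `|1 - z n|)).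
    by rewrite big_mkcond/= ler_sum// => n _; case: ifP.
  rewrite -sub_series_geq ?leq_addr// -[X in X <= _]ger0_norm; last first.
    by rewrite sub_series_geq ?leq_addr// sumr_ge0.
  rewrite (le_trans (ler_distD l _ _))// (splitr d) rmorphD lerD//.
    by rewrite distrC; apply: NP; rewrite /= leq_addr.
  by apply: NP; rewrite /=.
(* This choice keeps 2s below both e and 1. *)
pose d := Num.min e 1 / 2.
have d0 : 0 < d by rewrite divr_gt0// lt_min e0 ltr01.
have [N NP] := sumP _ d0; exists N => s su sN.
suff H r : \sum_(n <- r) `|1 - z n| <= d%:C%C ->
    `|\prod_(n <- r) z n - 1| <= 2 * \sum_(n <- r) `|1 - z n|.
  rewrite (le_trans (H _ (NP _ su sN)))//.
  rewrite (@le_trans _ _ (2 * d%:C%C))// ?ler_pM2l ?NP//.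
  rewrite -(rmorph_nat (real_complex R) 2) -rmorphM lecR /d mulrC divfK ?pnatr_eq0//.
  by rewrite ge_min lexx.
elim: r => [|n r IH]; first by rewrite !big_nil subrr normr0 mulr0.
rewrite !big_cons => rd.
have s0 : 0 <= \sum_(n <- r) `|1 - z n| by rewrite sumr_ge0.
have {}IH := IH (le_trans (ler_wpDl (normr_ge0 _) (lexx _)) rd).
have {rd} sd : 2 * \sum_(n <- r) `|1 - z n| <= 1.
  apply: (@le_trans _ _ (2 * d%:C%C)).
    by rewrite ler_pM2l// (le_trans _ rd)// ler_wpDl.
  rewrite -(rmorph_nat (real_complex R) 2) -rmorphM -(rmorph1 (real_complex R)) lecR.
  by rewrite /d mulrC divfK ?pnatr_eq0// ge_min lexx orbT.
set P := \prod_(n <- r) z n in IH *.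
have -> : z n * P - 1 = (P - 1) - (1 - z n) * P.
  by rewrite mulrBl mul1r opprB [RHS]addrC addrA subrK.
rewrite (le_trans (ler_normB _ _))// normrM mulrDr addrC lerD//.
rewrite mulrC ler_wpM2r// -(subrK 1 P) (le_trans (ler_normD _ _))// normr1.
by rewrite lerD2r (le_trans IH).
Qed.

Lemma small_tails_tail_ucvg z : small_tails z -> tail_ucvg z.
Proof.
move=> zt.
have zNt N : small_tails (tailseq N z).
  move=> e /zt[M MP]; exists (maxn M N) => s su sM.
  rewrite (eq_big_seq z) => [|n /(allP sM)]; last first.
    by rewrite geq_max /tailseq ltnNge => /andP[_ ->].
  by apply: MP => //; apply: sub_all sM => n; exact/leq_trans/leq_maxl.
have /choice[tau tauP] : forall N, exists a, ucvg_prod (tailseq N z) a.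
  by move=> N; exact: small_tails_ucvg.
exists tau => //; apply/cvgrPdist_le => _ /complex_pos[e e0 ->].
have [N NP] := zt _ e0; exists N => // M /= NM; rewrite distrC.
apply: (cvg_dist_le (ucvg_lim (tauP M))).
exists 0%N => // L _ /=; rewrite -(big_mkord xpredT (tailseq M z)).
rewrite /tailseq; under eq_bigr do rewrite ltnNge if_neg.
rewrite -big_mkcond/= -big_filter; apply: NP.
  by rewrite filter_uniq// iota_uniq.
by apply/allP => n; rewrite mem_filter => /andP[+ _]; exact: leq_trans.
Qed.

Lemma tail_ucvg_summable z : cvgn (series (fun n => `|1 - z n| : R[i])) -> tail_ucvg z.
Proof. by move=> /summable_small_tails; exact: small_tails_tail_ucvg. Qed.

End UnconditionalProducts.

Section ConjProducts.
Context {R : realType}.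
Implicit Types z : nat -> R[i].

Lemma cvg_conj (T : Type) (F : set_system T) {FF : Filter F} (f : T -> R[i]) (a : R[i]) :
  f x @[x --> F] --> a -> Num.conj (f x) @[x --> F] --> Num.conj a.
Proof.
move=> /cvgrPdist_lt fa; apply/cvgrPdist_lt => e /fa.
by apply: filterS => x; rewrite -rmorphB/= norm_conjC.
Qed.

Lemma tail_ucvg_conj z : tail_ucvg z -> tail_ucvg (fun n => Num.conj (z n)).
Proof.
move=> [t zt t1]; exists (fun N => Num.conj (t N)) => [N s sb|].
  have -> : (fun M => \prod_(n < M) tailseq N (fun n => Num.conj (z n)) (s n)) =
      (fun M => Num.conj (\prod_(n < M) tailseq N z (s n))).
    apply/funext => M; rewrite rmorph_prod; apply: eq_bigr => n _.
    by rewrite /tailseq; case: ifP; rewrite ?rmorph1.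
  by apply: cvg_conj; exact: zt.
by rewrite -[X in _ --> X](rmorph1 Num.conj); exact: cvg_conj.
Qed.

Lemma qprod_neq0 z : qprod z != 0 -> ucvg_prod z (qprod z).
Proof. by rewrite /qprod; case: xgetP => [a -> za _|_ /eqP]. Qed.

End ConjProducts.

(** * Hilbert spaces and closed spans *)

Section Hilbert.
Context {R : realType}.
Implicit Types H : hilbert R.

Lemma hdotC H (u v : H) : hdot u v = Num.conj (hdot v u).
Proof. by rewrite hermC expr0 mul1r. Qed.

Lemma hdot_ge0 H (u : H) : 0 <= hdot u u.
Proof. by rewrite -hnormE exprn_ge0. Qed.

Lemma sqnormB H (u v : H) :
  `|u - v| ^+ 2 = hdot u u - hdot u v - hdot v u + hdot v v.
Proof. by rewrite hnormE linearBl !linearBr/= opprB addrA addrAC. Qed.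

(** Positivity of the squared norm of the component of u orthogonal to v. *)
Lemma hilbert_CauchySchwarz H (u v : H) : `|hdot u v| <= `|u| * `|v|.
Proof.
have [->|v0] := eqVneq v 0; first by rewrite linear0r normr0 mulr_ge0.
have vv0 : 0 < hdot v v by rewrite -hnormE exprn_gt0// normr_gt0.
rewrite -(@ler_pXn2r _ 2)// ?nnegrE ?mulr_ge0// exprMn !hnormE.
pose a := hdot u v / hdot v v.
have := hdot_ge0 (u - a *: v).
have aC : Num.conj a = hdot v u / hdot v v.
  by rewrite rmorphM fmorphV/= -!hdotC.
have -> : hdot (u - a *: v) (u - a *: v) = hdot u u - `|hdot u v| ^+ 2 / hdot v v.
  have vN0 : hdot v v != 0 by rewrite gt_eqF.
  have hZr w : hdot w (a *: v) = Num.conj a * hdot w v by rewrite linearZr.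
  have hZl w : hdot (a *: v) w = a * hdot v w by rewrite linearZl.
  rewrite -hnormE sqnormB !hZl !hZr aC normCK -hdotC /a.
  by rewrite divfK// subrK mulrAC [hdot v u * _]mulrC.
by rewrite subr_ge0 ler_pdivrMr.
Qed.

Lemma hdot_cvg H (T : Type) (F : set_system T) {FF : Filter F} (f g : T -> H)
    (a b : H) : f x @[x --> F] --> a -> g x @[x --> F] --> b ->
  hdot (f x) (g x) @[x --> F] --> hdot a b.
Proof.
move=> fa gb; apply/cvgrPdist_lt => e e0.
have ub : (`|a - f x| * `|g x| + `|a| * `|b - g x|) @[x --> F] --> (0 : R[i]).
  rewrite -[X in _ --> X]addr0; apply: cvgD.
    rewrite -[X in _ --> X](mul0r `|b|); apply: cvgM; last exact: cvg_norm.
    rewrite -[X in _ --> X](normr0 H) -(subrr a); apply: cvg_norm.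
    by apply: cvgB => //; exact: cvg_cst.
  rewrite -[X in _ --> X](mulr0 `|a|); apply: cvgM; first exact: cvg_cst.
  rewrite -[X in _ --> X](normr0 H) -(subrr b); apply: cvg_norm.
  by apply: cvgB => //; exact: cvg_cst.
have /cvgr0_norm_lt/(_ e e0) := ub.
apply: filterS => x; rewrite ger0_norm ?addr_ge0 ?mulr_ge0//; apply: le_lt_trans.
have -> : hdot a b - hdot (f x) (g x) = hdot (a - f x) (g x) + hdot a (b - g x).
  by rewrite linearBl linearBr/= [RHS]addrC addrA subrK.
by rewrite (le_trans (ler_normD _ _))// lerD// hilbert_CauchySchwarz.
Qed.

Lemma cvg_sqnormB H (T : Type) (F : set_system T) {FF : Filter F} (f : T -> H) (a : H) :
  `|f x - a| ^+ 2 @[x --> F] --> (0 : R[i]) -> f x @[x --> F] --> a.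
Proof.
move=> fa; apply/cvgrPdist_lt => e e0.
have e20 : 0 < e ^+ 2 by rewrite exprn_gt0.
have /cvgr0_norm_lt/(_ _ e20) := fa; apply: filterS => x.
by rewrite ger0_norm ?exprn_ge0// ltr_pXn2r ?nnegrE ?(ltW e0)// distrC.
Qed.

Lemma bounded_op_cvg (V : hilbert R) (A : bounded_op V) (T : Type)
    (F : set_system T) {FF : Filter F} (f : T -> V) (a : V) : f x @[x --> F] --> a -> A (f x) @[x --> F] --> A a.
Proof.
have [M MP] := bop_bounded A; move=> /cvgrPdist_lt fa.
apply/cvgrPdist_lt => _ /complex_pos[e e0 ->].
have M0 : 0 < `|M| + 1 by rewrite ltr_wpDl.
have /fa : (0 : R[i]) < (e / (`|M| + 1))%:C%C by rewrite ltcR divr_gt0.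
apply: filterS => x; rewrite -raddfB => fx; apply: le_lt_trans (MP _) _.
apply: (@le_lt_trans _ _ ((`|M| + 1)%:C%C * `|a - f x|)).
  by rewrite ler_wpM2r// lecR (le_trans (ler_norm _))// lerDl.
have -> : e%:C%C = (`|M| + 1)%:C%C * (e / (`|M| + 1))%:C%C :> R[i].
  by rewrite -rmorphM mulrC divfK// gt_eqF.
by rewrite ltr_pM2l// ltcR.
Qed.

End Hilbert.

(** By Pythagoras a vector orthogonal to E is at distance at least its own norm
from every element of the span of E, so it cannot lie in the closure of that
span unless it vanishes. *)
Lemma orthogonal_cspan (R : realType) (V : hilbert R) (E : set V) (u : V) : cspan E u ->
  (forall e, E e -> hdot e u = 0) -> u = 0.
Proof.
move=> Eu E0; apply: contrapT => /eqP u0.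
have u0' : 0 < `|u| by rewrite normr_gt0.
have [v [[s sE ->] /=]] := Eu _ (nbhsx_ballx u _ u0').
rewrite -ball_normE/= -(@ltr_pXn2r _ 2)// ?nnegrE// sqnormB.
set w := \sum_(p <- s) _.
have wu : hdot w u = 0.
  rewrite /w linear_sumlz big_seq big1// => p /sE/E0 pu.
  by rewrite linearZl/= pu mulr0.
rewrite wu (hdotC u w) wu rmorph0 !subr0 -hnormE gtrDl.
by rewrite le_gtF// hdot_ge0.
Qed.

Section CspanInduction.
Context {R : realType} (V : hilbert R) (E : set V).

(** A property of vectors that is stable under linear combinations and sequential
limits only has to be checked on generators. *)
Lemma cspan_ind (P : cspan_space E -> Prop) :
  (forall x, E (val x) -> P x) -> P 0 ->
  (forall a u v, P u -> P v -> P (a *: u + v)) ->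
  (forall (u : nat -> cspan_space E) x, (forall n, P (u n)) ->
    u n @[n --> \oo] --> x -> P x) ->
  forall x, P x.
Proof.
move=> PE P0 PD Pl x.
have lift e : E e -> exists2 w, val w = e & P w.
  move=> Ee; have ce : e \in cspan_pred E.
    apply/asboolP; apply: subset_closure; exists [:: (1, e)].
      by move=> p; rewrite inE => /eqP ->.
    by rewrite big_seq1 scale1r.
  by exists (CSpan ce) => //; exact: PE.
have liftl (s : seq (R[i] * V)) : (forall p, p \in s -> E p.2) ->
    exists2 w, val w = \sum_(p <- s) p.1 *: p.2 & P w.
  elim: s => [_|p s IH sE]; first by exists 0; rewrite ?big_nil ?raddf0.
  have [w wE Pw] := IH (fun q qs => sE q (mem_behead (s := p :: s) qs)).
  have [v vE Pv] := lift _ (sE p (mem_head _ _)).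
  exists (p.1 *: v + w); last exact: PD.
  by rewrite big_cons -vE -wE [LHS]linearP.
have /choice[u uP] : forall n, exists w, P w /\ `|x - w| < (n.+1%:R^-1)%:C%C.
  move=> n; have n0 : (0 : R[i]) < (n.+1%:R^-1)%:C%C by rewrite ltcR invr_gt0.
  have /asboolP /(_ _ (nbhsx_ballx (val x) _ n0))[v [[s sE ->]]] := cspan_valP x.
  have [w <- Pw] := liftl s sE; rewrite -ball_normE/= => wx.
  by exists w; split=> //; rewrite cspan_normE raddfB.
apply: (Pl u) => [n|]; first by have [] := uP n.
apply/cvgrPdist_lt => _ /complex_pos[e e0 ->].
have := near_infty_natSinv_lt (PosNum e0); apply: filterS => n ne.
by have [_ /lt_trans->//] := uP n; rewrite ltcR.
Qed.

End CspanInduction.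

(** * Changing the tail of an elementary tensor *)

Section Tensors.
Context {R : realType} (H : nat -> hilbert R) (K : complete_tensor H).

Definition splice N (f g : forall n, H n) : forall n, H n :=
  fun n => if (n < N)%N then f n else g n.

Lemma is_cseq_splice N f g : tail_ucvg (fun n => `|g n|) -> is_cseq (splice N f g).
Proof.
move=> [t gt _]; have := @ucvg_splice _ N (fun n => `|f n|) _ _ (gt N).
set w := (fun n => _); have -> : w = (fun n => `|splice N f g n|).
  by apply/funext => n; rewrite /w /splice; case: ifP.
by move=> wt; eexists; exact: wt.
Qed.

Definition splice_cseq N f g (gt : tail_ucvg (fun n => `|g n|)) : cseq H :=
  CSeq (is_cseq_splice N f gt).

(** A C-sequence carries a proof of its convergence property, which does not
affect its tensor. *)
Lemma tensor_ext (f g : cseq H) : (forall n, f n = g n) -> tensor K f = tensor K g.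
Proof.
move=> fg; congr (tensor K _); case: f g fg => [f fc] [g gc] /= fg.
have E : f = g by apply: functional_extensionality_dep.
by move: fc; rewrite E => fc; congr CSeq; exact: Prop_irrelevance.
Qed.

Lemma hdot_tensor_ucvg (f g : cseq H) a :
  ucvg_prod (fun n => hdot (f n) (g n)) a -> hdot (tensor K f) (tensor K g) = a.
Proof. by move=> fga; rewrite /tensor ct_emb_dot; exact: qprodE. Qed.

(** Only the tail decides on convergence: the head may be arbitrary and simply
contributes its finite product of inner products. *)
Lemma hdot_splicel N f g gt (h : cseq H) t :
  ucvg_prod (tailseq N (fun n => hdot (g n) (h n))) t ->
  hdot (tensor K (@splice_cseq N f g gt)) (tensor K h) =
  \prod_(n < N) hdot (f n) (h n) * t.
Proof.
move=> /(@ucvg_splice _ N (fun n => hdot (f n) (h n))) ft; apply: hdot_tensor_ucvg.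
set w := (fun n => _) in ft; set w' := (fun n => _).
suff -> : w' = w by [].
by apply/funext => n; rewrite /w /w' /= /splice; case: ifP.
Qed.

Lemma hdot_splice N f f' g g' gt gt' t :
  ucvg_prod (tailseq N (fun n => hdot (g n) (g' n))) t ->
  hdot (tensor K (@splice_cseq N f g gt)) (tensor K (@splice_cseq N f' g' gt')) =
  \prod_(n < N) hdot (f n) (f' n) * t.
Proof.
move=> gg't; rewrite (@hdot_splicel N f g gt (splice_cseq N f' gt') t).
  by congr (_ * _); apply: eq_bigr => n _; rewrite /= /splice ltn_ord.
set w := tailseq N _; suff -> : w = tailseq N (fun n => hdot (g n) (g' n)) by [].
by apply/funext => n; rewrite /w /tailseq /= /splice; case: (n < N)%N.
Qed.

Lemma tail_ucvg_hdot (g : forall n, H n) : tail_ucvg (fun n => `|g n|) ->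
  tail_ucvg (fun n => hdot (g n) (g n)).
Proof.
move=> gt; have := tail_ucvgM gt gt.
suff -> : (fun n => `|g n| * `|g n|) = (fun n => hdot (g n) (g n)) by [].
by apply/funext => n; rewrite -hnormE expr2.
Qed.

(** Expanding the squared distance gives the head product of the |f_n|^2, common to
all four terms, times an alternating sum of four tail products that all tend
to 1. *)
Lemma splice_close (f g g' : forall n, H n) gt gt' (c : R[i]) :
  \prod_(n < N) hdot (f n) (f n) @[N --> \oo] --> c ->
  tail_ucvg (fun n => hdot (g n) (g' n)) ->
  tensor K (@splice_cseq N f g gt) - tensor K (@splice_cseq N f g' gt')
    @[N --> \oo] --> (0 : K).
Proof.
move=> fc gg'; apply: cvg_sqnormB.
have [t1 T1 T11] := tail_ucvg_hdot gt.
have [t2 T2 T21] := gg'.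
have [t3 T3 T31] := tail_ucvg_conj gg'.
have [t4 T4 T41] := tail_ucvg_hdot gt'.
have {}T3 N : ucvg_prod (tailseq N (fun n => hdot (g' n) (g n))) (t3 N).
  have := T3 N; suff -> : (fun n => Num.conj (hdot (g n) (g' n))) =
    (fun n => hdot (g' n) (g n)) by [].
  by apply/funext => n; rewrite -hdotC.
have -> : (fun N => `|tensor K (@splice_cseq N f g gt) -
    tensor K (@splice_cseq N f g' gt') - 0| ^+ 2) =
    (fun N => \prod_(n < N) hdot (f n) (f n) * (t1 N - t2 N - t3 N + t4 N)).
  apply/funext => N; rewrite subr0 sqnormB (hdot_splice _ _ _ _ (T1 N)).
  rewrite (hdot_splice _ _ _ _ (T2 N)) (hdot_splice _ _ _ _ (T3 N)).
  by rewrite (hdot_splice _ _ _ _ (T4 N)) mulrDr !mulrBr.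
rewrite -[X in _ --> X](mulr0 c) -[X in c * X](subrr (1 : R[i])).
rewrite -[X in c * (X - 1)](subrK 1 (1 : R[i])) -[1 - 1 + 1 - 1]addrAC.
exact: (cvgM fc (cvgD (cvgB (cvgB T11 T21) T31) T41)).
Qed.

Variable y : cseq H.

Definition equiv_tensors : set K :=
  [set tensor K h | h in [set h | is_c0seq h /\ c0equiv h y]].

(** Comparing f with y directly would need the equivalence of f and y. Membership
in the closed span instead produces some g equivalent to y whose tensor is not
orthogonal to that of f; a nonzero value of the quasi-convergent product is
necessarily an unconditional limit, so g is comparable with f, and it is
comparable with y by equivalence. *)
Theorem tensor_splice_cvg (f : cseq H) (yt : tail_ucvg (fun n => `|y n|)) :
  cspan equiv_tensors (tensor K f) ->
  tensor K (@splice_cseq N f y yt) @[N --> \oo] --> tensor K f.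
Proof.
move=> fy; have [a fa] := cseqP f.
have ffa : ucvg_prod (fun n => hdot (f n) (f n)) (a * a).
  have := ucvgM fa fa.
  suff -> : (fun n => `|f n| * `|f n|) = (fun n => hdot (f n) (f n)) by [].
  by apply/funext => n; rewrite -hnormE expr2.
have fc := ucvg_lim ffa.
have f2 : `|tensor K f| ^+ 2 = a * a by rewrite hnormE (hdot_tensor_ucvg ffa).
have [f0|f0] := eqVneq (tensor K f) 0.
  have aa0 : a * a = 0 by rewrite -f2 f0 normr0 expr0n.
  (* The squared norms are head products of the |f_n|^2, which tend to the squared
     norm of a zero tensor, times tail products of the |y_n|^2. *)
  rewrite f0; apply: cvg_sqnormB.
  have [t T T1] := tail_ucvg_hdot yt.
  have -> : (fun N => `|tensor K (@splice_cseq N f y yt) - 0| ^+ 2) =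
      (fun N => \prod_(n < N) hdot (f n) (f n) * t N).
    by apply/funext => N; rewrite subr0 hnormE (hdot_splice _ _ _ _ (T N)).
  rewrite -[X in _ --> X](mul0r (1 : R[i])) -[X in X * 1]aa0.
  exact: (cvgM fc T1).
have a0 : a != 0.
  by apply: contra_neq f0 => a0; apply/eqP; rewrite -normr_eq0 -sqrf_eq0 f2 a0 mul0r.
have ft := tail_ucvg_neq0 fa a0.
have [g [[g0 gy] gf]] : exists g : cseq H, (is_c0seq g /\ c0equiv g y) /\
    hdot (tensor K f) (tensor K g) != 0.
  apply: contrapT => nog; move/eqP: f0; apply; apply: (orthogonal_cspan fy).
  move=> _ [g [g0 gy] <-]; rewrite hdotC; apply: contrapT => /eqP gf.
  by apply: nog; exists g; split=> //; apply: contra_neq gf => ->; rewrite rmorph0.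
have fg : tail_ucvg (fun n => hdot (f n) (g n)).
  move: gf; rewrite /tensor ct_emb_dot => gf.
  by apply: (tail_ucvg_neq0 (qprod_neq0 gf)).
have gt : tail_ucvg (fun n => `|g n|) := tail_ucvg_summable g0.
have fE N : tensor K f = tensor K (@splice_cseq N f f ft).
  by apply: tensor_ext => n /=; rewrite /splice; case: ifP.
have D1 := splice_close ft gt fc fg.
have D2 := splice_close gt yt fc (tail_ucvg_summable gy).
have -> : (fun N => tensor K (@splice_cseq N f y yt)) = (fun N => tensor K f -
    ((tensor K (@splice_cseq N f f ft) - tensor K (@splice_cseq N f g gt)) +
     (tensor K (@splice_cseq N f g gt) - tensor K (@splice_cseq N f y yt)))).
  by apply/funext => N; rewrite addrA subrK -fE opprB addrCA subrr addr0.
rewrite -[X in _ --> X]subr0 -[X in _ - X](addr0 (0 : K)).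
exact: (cvgB (cvg_cst (tensor K f)) (cvgD D1 D2)).
Qed.

End Tensors.

Lemma tensor_orbit_cvg (R : realType) (H : nat -> hilbert R)
    (K : complete_tensor H) (y : cseq H) (yt : tail_ucvg (fun n => `|y n|))
    (A : forall n, bounded_op (H n)) (B : bounded_op (incomplete_tensor K y))
    (h : cseq H) (x : incomplete_tensor K y) :
  is_tensor_op A B -> val x = tensor K h ->
  tensor K (splice_cseq N (fun n => A n (h n)) yt) @[N --> \oo] --> val (B x).
Proof.
move=> AB xh; have [Ah AhE BxE] := AB h x xh.
have AhE' : (fun n => A n (h n)) = Ah.
  by apply: functional_extensionality_dep => n; rewrite AhE.
rewrite BxE AhE'; apply: tensor_splice_cvg.
by rewrite -BxE; have /asboolP := cspan_valP (B x).
Qed.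

Lemma cvg_prod_ord (R : realType) (T : Type) (F : set_system T) {FF : Filter F}
    (f : nat -> T -> R[i]) (a : nat -> R[i]) N :
  (forall n, f n x @[x --> F] --> a n) ->
  \prod_(n < N) f n x @[x --> F] --> \prod_(n < N) a n.
Proof.
move=> fa; elim: N => [|N IH].
  by under eq_fun do rewrite big_ord0; rewrite big_ord0; exact: cvg_cst.
by under eq_fun do rewrite big_ord_recr; rewrite big_ord_recr; exact: (cvgM IH (fa N)).
Qed.

(** The squared distance is a fixed tail product times a polynomial in finitely many
inner products, in which everything cancels in the limit. *)
Lemma splice_continuous (R : realType) (H : nat -> hilbert R) (K : complete_tensor H)
    (y : forall n, H n) (yt : tail_ucvg (fun n => `|y n|)) N (S : Type) (F : set_system S)
    {FF : Filter F} (f : S -> forall n, H n) (a : forall n, H n) :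
  (forall n, f s n @[s --> F] --> a n) ->
  tensor K (splice_cseq N (f s) yt) @[s --> F] --> tensor K (splice_cseq N a yt).
Proof.
move=> fa; apply: cvg_sqnormB; have [t yt1 _] := tail_ucvg_hdot yt.
pose P (u v : forall n, H n) := \prod_(n < N) hdot (u n) (v n).
have -> : (fun s => `|tensor K (splice_cseq N (f s) yt) -
    tensor K (splice_cseq N a yt)| ^+ 2) =
    (fun s => (P (f s) (f s) - P (f s) a - P a (f s) + P a a) * t N).
  apply/funext => s; rewrite sqnormB !(@hdot_splice _ _ K N _ _ _ _ yt yt _ (yt1 N)).
  by rewrite mulrDl !mulrBl.
have Pc (u v : S -> forall n, H n) : (forall n, u s n @[s --> F] --> a n) ->
    (forall n, v s n @[s --> F] --> a n) -> P (u s) (v s) @[s --> F] --> P a a.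
  move=> ua va; apply: (@cvg_prod_ord R S F FF (fun n s => hdot (u s n) (v s n))
      (fun n => hdot (a n) (a n))) => n.
    exact: hdot_cvg.
have ca n : a n @[_ --> F] --> a n by exact: cvg_cst.
have <- : (P a a - P a a - P a a + P a a) * t N = 0.
  by rewrite subrr sub0r addNr mul0r.
exact: (cvgM (cvgD (cvgB (cvgB (Pc _ _ fa fa) (Pc _ _ fa ca)) (Pc _ _ ca fa))
  (Pc _ _ ca ca)) (cvg_cst (t N))).
Qed.

(** * Weak measurability *)

Section ComplexMeasurability.
Context {R : realType} {d : measure_display} {T : measurableType d} (D : set T).
Implicit Types f g : T -> R[i].

Lemma measurable_Re f : @measurable_fun _ _ T (@borelC R) D f ->
  measurable_fun D (fun x => complex.Re (f x)).
Proof.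
move=> mf; suff mRe : @measurable_fun _ _ (@borelC R) R setT (@complex.Re R).
  exact: (measurableT_comp mRe mf).
move=> mT; apply: (measurability _ (RGenOInfty.measurableE R)) => //.
move=> _ [_ [x ->] <-]; apply: sub_sigma_algebra; rewrite setTI.
rewrite /= openE => z /=; rewrite in_itv/= andbT => xz.
have zz : complex.Re w @[w --> z] --> complex.Re z 
  by exact: (@cvg_Re R _ (nbhs z) _ id z (@cvg_id _ _)).
have zx : nbhs z [set w | x < complex.Re w] := zz _ (lt_nbhsr xz).
by apply: filterS zx => w /=; rewrite in_itv/= andbT.
Qed.

Lemma measurable_Im f : @measurable_fun _ _ T (@borelC R) D f ->
  measurable_fun D (fun x => complex.Im (f x)).
Proof.
move=> mf; suff mRe : @measurable_fun _ _ (@borelC R) R setT (@complex.Im R).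
  exact: (measurableT_comp mRe mf).
move=> mT; apply: (measurability _ (RGenOInfty.measurableE R)) => //.
move=> _ [_ [x ->] <-]; apply: sub_sigma_algebra; rewrite setTI.
rewrite /= openE => z /=; rewrite in_itv/= andbT => xz.
have zz : complex.Im w @[w --> z] --> complex.Im z 
  by exact: (@cvg_Im R _ (nbhs z) _ id z (@cvg_id _ _)).
have zx : nbhs z [set w | x < complex.Im w] := zz _ (lt_nbhsr xz).
by apply: filterS zx => w /=; rewrite in_itv/= andbT.
Qed.

(** An open set of complex numbers is the countable union of the rectangles with
rational corners that it contains, and preimages of rectangles are controlled
by the real and imaginary parts. *)
Lemma measurable_ReIm f : measurable_fun D (fun x => complex.Re (f x)) ->
  measurable_fun D (fun x => complex.Im (f x)) ->
  @measurable_fun _ _ T (@borelC R) D f.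
Proof.
move=> mRe mIm mD.
have mfE : @measurable _ (@borelC R) = <<s @open R[i] >> by [].
apply: (measurability _ mfE) => // _ [U oU <-].
pose box (q : (rat * rat) * (rat * rat)) : set R[i] := [set z |
  (complex.Re z \in `]ratr q.1.1, ratr q.1.2[) /\
  (complex.Im z \in `]ratr q.2.1, ratr q.2.2[)].
have -> : D `&` f @^-1` U = \bigcup_(q in [set q | box q `<=` U])
    ((D `&` (fun x => complex.Re (f x)) @^-1` `]ratr q.1.1, ratr q.1.2[) `&`
     (D `&` (fun x => complex.Im (f x)) @^-1` `]ratr q.2.1, ratr q.2.2[)).
  apply/seteqP; split=> [x [Dx Ufx]|x [q qU [[Dx xr] [_ xi]]]]; last first.
    by split=> //; exact: (qU (f x)).
  have /nbhs_ballP[_ /complex_pos[e e0 ->] eU] : nbhs (f x) U.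
    exact: (open_nbhs_nbhs (conj oU Ufx)).
  have e20 : 0 < e / 2 by rewrite divr_gt0.
  have around (r : R) : exists2 q : rat * rat, r \in `]ratr q.1, ratr q.2[ &
      forall s, s \in `]ratr q.1, ratr q.2[ -> `|r - s| < e / 2.
    have [p] : exists q, ratr q \in `]r - e / 4, r[.
      by apply: rat_in_itvoo; lra.
    have [q] : exists q, ratr q \in `]r, r + e / 4[.
      by apply: rat_in_itvoo; lra.
    rewrite !in_itv/= => /andP[q1 q2] /andP[p1 p2].
    exists (p, q); rewrite /= ?in_itv/= ?p2 ?q1// => s.
    by rewrite in_itv/= => /andP[s1 s2]; rewrite ltr_norml; apply/andP; split; lra.
  have [qr xqr qrs] := around (complex.Re (f x)).
  have [qi xqi qis] := around (complex.Im (f x)).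
  exists (qr, qi) => //= z [zr zi]; apply: eU; rewrite -ball_normE/=.
  rewrite (le_lt_trans (normc_le_ReIm _))// ltcR (splitr e) !raddfB.
  by apply: ltrD; [exact: qrs|exact: qis].
rewrite bigcup_mkcond; apply: countable_bigcupT_measurable => // q.
case: ifP => _; last exact: measurable0.
by apply: measurableI; [apply: mRe|apply: mIm].
Qed.

Lemma measurable_complexM f g : @measurable_fun _ _ T (@borelC R) D f ->
  @measurable_fun _ _ T (@borelC R) D g ->
  @measurable_fun _ _ T (@borelC R) D (fun x => f x * g x).
Proof.
move=> mf mg.
have [fr fi] := (measurable_Re mf, measurable_Im mf).
have [gr gi] := (measurable_Re mg, measurable_Im mg).
apply: measurable_ReIm.
  apply: (eq_measurable_fun (fun x => complex.Re (f x) * complex.Re (g x) -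
      complex.Im (f x) * complex.Im (g x))).
    by move=> x _; case: (f x) => ? ?; case: (g x).
  by apply: measurable_funB; exact: measurable_funM.
apply: (eq_measurable_fun (fun x => complex.Re (f x) * complex.Im (g x) +
    complex.Im (f x) * complex.Re (g x))).
  by move=> x _; case: (f x) => ? ?; case: (g x).
by apply: measurable_funD; exact: measurable_funM.
Qed.

Lemma measurable_complexD f g : @measurable_fun _ _ T (@borelC R) D f ->
  @measurable_fun _ _ T (@borelC R) D g ->
  @measurable_fun _ _ T (@borelC R) D (fun x => f x + g x).
Proof.
move=> mf mg.
have [fr fi] := (measurable_Re mf, measurable_Im mf).
have [gr gi] := (measurable_Re mg, measurable_Im mg).
apply: measurable_ReIm.
  apply: (eq_measurable_fun (fun x => complex.Re (f x) + complex.Re (g x))).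
    by move=> x _; rewrite raddfD.
  exact: measurable_funD.
apply: (eq_measurable_fun (fun x => complex.Im (f x) + complex.Im (g x))).
  by move=> x _; rewrite raddfD.
exact: measurable_funD.
Qed.

(** Reduced to the real case, where the pointwise limit is a limit superior. *)
Lemma measurable_complex_cvg (h : nat -> T -> R[i]) f :
  (forall n, @measurable_fun _ _ T (@borelC R) D (h n)) ->
  (forall x, D x -> h n x @[n --> \oo] --> f x) ->
  @measurable_fun _ _ T (@borelC R) D f.
Proof.
move=> mh hf; apply: measurable_ReIm.
  apply: (measurable_fun_cvg (fun n => measurable_Re (mh n))) => x Dx.
  exact: cvg_Re (hf x Dx).
apply: (measurable_fun_cvg (fun n => measurable_Im (mh n))) => x Dx.
exact: cvg_Im (hf x Dx).
Qed.

Lemma measurable_complex_prod (h : nat -> T -> R[i]) N :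
  (forall n, @measurable_fun _ _ T (@borelC R) D (h n)) ->
  @measurable_fun _ _ T (@borelC R) D (fun x => \prod_(n < N) h n x).
Proof.
move=> mh; elim: N => [|N IH].
  apply: (eq_measurable_fun (fun=> 1 : @borelC R)); last exact: measurable_cst.
  by move=> x _; rewrite big_ord0.
apply: (eq_measurable_fun (fun x => (\prod_(n < N) h n x * h N x : @borelC R))).
  by move=> x _; rewrite big_ord_recr.
exact: measurable_complexM.
Qed.

End ComplexMeasurability.

(** The matrix coefficients of TT between elementary tensors are pointwise limits of
finite products of coefficients of the T_n, up to constant tail factors; both
vectors are then generalized by induction over the closed span. *)
Lemma weakly_measurable_tensor (R : realType) (H : nat -> hilbert R)
    (K : complete_tensor H) (y : cseq H) (y_c0 : is_c0seq y)
    (T : forall n : nat, R -> bounded_op (H n))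
    (TT : R -> bounded_op (incomplete_tensor K y)) :
  (forall t, 0 <= t -> is_tensor_op (fun n => T n t) (TT t)) ->
  (forall n, weakly_measurable (T n)) -> weakly_measurable TT.
Proof.
move=> TT_tensor mT; have yt := tail_ucvg_summable y_c0.
pose M (f : R -> R[i]) :=
  @measurable_fun _ _ (@lebesgueR R) (@borelC R) [set t : R | 0 <= t] f.
have eqM f g : f =1 g -> M f -> M g by move=> /funext ->.
apply: cspan_ind => [x [h _ hx]|||].
- apply: cspan_ind => [z [g [_ gy] gz]|||].
  + have [tau ytau _] := tail_ucvg_conj (tail_ucvg_summable gy).
    have {}ytau N : ucvg_prod (tailseq N (fun n => hdot (y n) (g n))) (tau N).
      suff -> : (fun n => hdot (y n) (g n)) = (fun n => Num.conj (hdot (g n) (y n))).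
        exact: ytau.
      by apply/funext => n; rewrite -hdotC.
    apply: (@measurable_complex_cvg R _ (@lebesgueR R) _ (fun N t =>
      \prod_(n < N) hdot (T n t (h n)) (g n) * tau N)) => [N|t /= t0].
      apply: measurable_complexM; last exact: measurable_cst.
      exact: (measurable_complex_prod N (fun n => mT n (h n) (g n))).
    have := hdot_cvg (tensor_orbit_cvg yt (TT_tensor t t0) (esym hx)) (cvg_cst (tensor K g)).
    under eq_fun do rewrite (@hdot_splicel _ _ K _ _ _ yt g _ (ytau _)).
    by rewrite gz => xz; exact: xz.
  + apply: (eqM (fun=> 0)); last exact: measurable_cst.
    by move=> t; rewrite linear0r.
  + move=> a u v mu mv.
    apply: (eqM (fun t => Num.conj a * hdot (TT t x) u + hdot (TT t x) v)).
      by move=> t; rewrite linearPr.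
    apply: measurable_complexD; last exact: mv.
    by apply: measurable_complexM; [exact: measurable_cst|exact: mu].
  + move=> u z mu uz; apply: (measurable_complex_cvg mu) => t _.
    by apply: hdot_cvg; [exact: cvg_cst|exact: uz].
- move=> g; apply: (eqM (fun=> 0)); last exact: measurable_cst.
  by move=> t; rewrite linear0 linear0l.
- move=> a u v mu mv g.
  apply: (eqM (fun t => a * hdot (TT t u) g + hdot (TT t v) g)).
    by move=> t; rewrite linearP linearPl.
  apply: measurable_complexD; last exact: mv.
  by apply: measurable_complexM; [exact: measurable_cst|exact: mu].
- move=> u x mu ux g; apply: (measurable_complex_cvg (fun n => mu n g)) => t _.
  by apply: hdot_cvg; [exact: bounded_op_cvg|exact: cvg_cst].
Qed.

(** * Strong continuity by the Baire category theorem *)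

Section BaireOne.
Context {R : realType} (V : normedModType R[i]).

Lemma open_norm_gt (g : R -> V) (d : R) :
  (forall x, g y @[y --> x] --> g x) -> open [set x | d%:C%C < `|g x|].
Proof.
move=> gc; rewrite openE => x /= dgx.
have /cvgrPdist_lt/(_ (`|g x| - d%:C%C)) := gc x.
rewrite subr_gt0 => /(_ dgx); apply: filterS => z /=.
rewrite ltrBrDr -ltrBrDl => /lt_le_trans; apply.
rewrite lerBlDr (le_trans _ (ler_normD _ _))//.
by rewrite addrC subrK.
Qed.

(** A point at which f has oscillation at most e has an open neighbourhood on which
values of f differ by at most e, and continuity points are those lying in
these open sets for every e. The sets are dense: in an open set J, the points
where all F m and F n with m, n >= N are within d of each other exhaust J as
N grows, so by the Baire category theorem one of these sets contains an open
set, on which f is within d of the continuous function F N. *)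
Lemma baire_one_continuity (F : nat -> R -> V) (f : R -> V) :
  (forall n x, F n y @[y --> x] --> F n x) ->
  (forall x, F n x @[n --> \oo] --> f x) ->
  dense [set x | f y @[y --> x] --> f x].
Proof.
move=> Fc Ff.
pose small e := [set O : set R | open O /\
  forall u v, O u -> O v -> `|f u - f v| <= e%:C%C].
pose osc e : set R := \bigcup_(O in small e) O.
have osc_open e : open (osc e) by apply: bigcup_open => O [].
have osc_dense e : 0 < e -> dense (osc e).
  move=> e0 J J0 Jo; apply: contrapT => Josc.
  (* The oscillation estimate passes through four distances of size d. *)
  pose d := e / 4.
  have d0 : 0 < d by rewrite divr_gt0.
  pose far N : set R := \bigcup_(p in [set p : nat * nat | (N <= p.1)%N /\ (N <= p.2)%N])
    [set x | d%:C%C < `|F p.1 x - F p.2 x|].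
  (* Adding the exterior of J makes density a statement about the whole line, as
     the category theorem requires. *)
  pose G N := far N `|` interior (~` J).
  have Go N : open (G N).
    apply: openU; last exact: open_interior.
    by apply: bigcup_open => p _; apply: open_norm_gt => x; apply: cvgB; exact: Fc.
  have Gd N : dense (G N).
    move=> O O0 Oo; have [[x0 [Ox0 Jx0]]|OJ] := pselect (O `&` J !=set0); last first.
      have [x Ox] := O0; exists x; split=> //; right.
      by apply: filterS (open_nbhs_nbhs (conj Oo Ox)) => z Oz Jz; apply: OJ; exists z.
    apply: contrapT => OG.
    have near_f x : O x -> J x -> `|f x - F N x| <= d%:C%C.
      move=> Ox Jx; apply: (cvg_dist_le (Ff x)); exists N => // n /= Nn.
      have [//|FnN] := boolP (`|F n x - F N x| <= d%:C%C).
      exfalso; apply: OG; exists x; split=> //; left; exists (n, N) => //=.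
      rewrite real_ltNge// ?normr_real//.
      by rewrite gtr0_real// ltcR.
    have d0' : (0 : R[i]) < d%:C%C by rewrite ltcR.
    have /cvgrPdist_lt/(_ _ d0') Fx0 := Fc N x0.
    pose B := interior [set x | [/\ O x, J x & `|F N x0 - F N x| < d%:C%C]].
    have Bx0 : B x0.
      have Ox := open_nbhs_nbhs (conj Oo Ox0).
      have Jx := open_nbhs_nbhs (conj Jo Jx0).
      by apply: filterS (filterI (filterI Ox Jx) Fx0) => x [[]].
    apply: Josc; exists x0; split=> //; exists B => //; split; first exact: open_interior.
    move=> u v /interior_subset[Ou Ju Fu] /interior_subset[Ov Jv Fv].
    have -> : e%:C%C = (d%:C%C + d%:C%C) + (d%:C%C + d%:C%C) :> R[i].
      by rewrite -!rmorphD/= /d; congr (_%:C%C); lra.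
    apply: le_trans (ler_distD (F N x0) _ _) _; apply: lerD.
      apply: le_trans (ler_distD (F N u) _ _) _; apply: lerD; first exact: near_f.
      by rewrite distrC; exact: ltW.
    apply: le_trans (ler_distD (F N v) _ _) _; apply: lerD; first exact: ltW.
    by rewrite distrC; exact: near_f.
  have [x [Jx Gx]] := @Baire R R G (fun N => conj (Go N) (Gd N)) J J0 Jo.
  have d20 : (0 : R[i]) < (d / 2)%:C%C by rewrite ltcR divr_gt0.
  have /cvgrPdist_le/(_ _ d20)[N _ NP] := Ff x.
  have [[p [p1 p2]]|/interior_subset//] := Gx N I.
  apply/negP; rewrite /= -real_leNgt ?normr_real//; last by rewrite gtr0_real// ltcR.
  rewrite (le_trans (ler_distD (f x) _ _))// (splitr d) rmorphD lerD//.
    by rewrite distrC; exact: NP.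
  exact: NP.
have D := @Baire R R (fun n => osc n.+1%:R^-1)
  (fun n => conj (osc_open _) (osc_dense n.+1%:R^-1 ltac:(by rewrite invr_gt0))).
move=> J J0 Jo; have [x [Jx ox]] := D J J0 Jo.
exists x; split=> //=; apply/cvgrPdist_lt => _ /complex_pos[e e0 ->].
have [n ne] : exists n, n.+1%:R^-1 < e.
  by have [n _ /(_ n (leqnn _))] := near_infty_natSinv_lt (PosNum e0); exists n.
have [O [Oo Of] Ox] := ox n I.
apply: filterS (open_nbhs_nbhs (conj Oo Ox)) => z Oz.
by rewrite (le_lt_trans (Of _ _ Ox Oz))// ltcR.
Qed.

End BaireOne.

Section Orbits.
Context {R : realType} (V : hilbert R).

(** An orbit that is continuous at t1 is continuous at each later t, since T s x is
T (t - t1) applied to T (s - (t - t1)) x; and points of continuity t1 exist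
before any given t because the orbit is of Baire class one. The isometry iota
allows the approximating functions to take their values in a larger space. *)
Lemma orbit_continuous (K : normedModType R[i]) (iota : V -> K)
    (T : R -> bounded_op V) (x : V) (F : nat -> R -> K) :
  (forall u v, `|iota u - iota v| = `|u - v|) -> semigroup T ->
  (forall n (t : R), 0 < t -> F n s @[s --> t] --> F n t) ->
  (forall t : R, 0 < t -> F n t @[n --> \oo] --> iota (T t x)) ->
  forall t : R, 0 < t -> T s x @[s --> t] --> T t x.
Proof.
move=> iotaE [T0 TD] Fc FT t t0; have a0 : 0 < t / 2 by rewrite divr_gt0.
pose a := t / 2.
(* A continuous map of the line into the positive half-line that is the identity
   beyond a; composing with it extends the functions to the whole line without
   changing them near the point of continuity found between a and t. *)
pose m s := a + `|s - a|.
have m0 s : 0 < m s by rewrite ltr_wpDr.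
have mE s : a < s -> m s = s.
  by move=> as_; rewrite /m ger0_norm ?subr_ge0 ?ltW// addrC subrK.
have mc (s : R) : m r @[r --> s] --> m s.
  apply: cvgD; first exact: cvg_cst.
  by apply: cvg_norm; apply: cvgB => //; exact: cvg_cst.
have Gc n s : F n (m r) @[r --> s] --> F n (m s).
  exact: (cvg_comp _ _ (mc s) (Fc n _ (m0 s))).
have GT s : F n (m s) @[n --> \oo] --> iota (T (m s) x).
  exact: FT.
have J0 : `]a, t[%classic !=set0.
  by exists ((a + t) / 2); rewrite /= in_itv/=; apply/andP; rewrite /a; split; lra.
have Jo : open `]a, t[%classic by exact: interval_open.
have [t1 [t1J Tc]] := baire_one_continuity Gc GT J0 Jo.
move: t1J; rewrite /= in_itv/= => /andP[at1 t1t].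
have {Tc} Tc : T s x @[s --> t1] --> T t1 x.
  apply/cvgrPdist_lt => e e0; have /cvgrPdist_lt/(_ _ e0) := Tc.
  have : \forall s \near t1, a < s by exact: lt_nbhsr.
  apply: filterS2 => s as_; rewrite iotaE !mE//.
pose r := t - t1.
have r0 : 0 <= r by rewrite subr_ge0 ltW.
have tE : t = r + t1 by rewrite subrK.
have sc : T (s - r) x @[s --> t] --> T t1 x.
  apply: cvg_comp Tc; have -> : t1 = t - r by rewrite tE addrC addKr.
  by apply: cvgB => //; exact: cvg_cst.
have := bounded_op_cvg (A := T r) sc.
rewrite -TD//; last by rewrite (le_trans (ltW a0))// ltW.
rewrite -tE => Trc; apply: cvg_trans (Trc _); apply: near_eq_cvg.
have : \forall s \near t, r < s by apply: lt_nbhsr; rewrite gtrBl (lt_trans a0).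
apply: filterS => s rs; rewrite -TD ?subr_ge0 ?ltW//.
by rewrite addrC subrK.
Qed.

End Orbits.

(** The orbit of an elementary tensor is approximated by tensors with tail y, and
the orbit of a limit of vectors u_k by the orbits of the u_k; in both cases
[orbit_continuous] turns pointwise approximation into continuity. *)
Lemma strongly_continuous_tensor (R : realType) (H : nat -> hilbert R)
    (K : complete_tensor H) (y : cseq H) (y_c0 : is_c0seq y)
    (T : forall n : nat, R -> bounded_op (H n))
    (TT : R -> bounded_op (incomplete_tensor K y)) :
  (forall t, 0 <= t -> is_tensor_op (fun n => T n t) (TT t)) -> semigroup TT ->
  (forall n, strongly_continuous (T n)) -> strongly_continuous TT.
Proof.
move=> TT_tensor sTT cT; have yt := tail_ucvg_summable y_c0.
have valE (u v : incomplete_tensor K y) : `|val u - val v| = `|u - v|.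
  by rewrite -raddfB.
have at_pos (V : hilbert R) (f : R -> V) :
    (forall t : R, 0 < t -> f s @[s --> t] --> f t) <->
    {within [set t : R | 0 < t], continuous f}.
  rewrite continuous_open_subspace; last exact: open_gt.
  split=> fc t; first by rewrite inE; exact: fc.
  by move=> t0; apply: fc; rewrite inE.
move=> x; apply/at_pos; move: x; apply: cspan_ind => [x [h _ hx]|||].
- apply: (@orbit_continuous R (incomplete_tensor K y) K val TT x (fun N t =>
    tensor K (splice_cseq N (fun n => T n t (h n)) yt)) valE sTT) => [N t t0|t t0].
    apply: splice_continuous => n.
    by move: t t0; apply/at_pos; exact: cT.
  exact: (tensor_orbit_cvg yt (TT_tensor t (ltW t0)) (esym hx)).
- move=> t t0; under eq_fun do rewrite linear0.
  by rewrite linear0; exact: cvg_cst.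
- move=> a u v cu cv t t0; under eq_fun do rewrite linearP.
  rewrite linearP; apply: cvgD; last exact: cv.
  by apply: cvgZr; exact: cu.
- have val_cvg (S : Type) (F : set_system S) (FF : Filter F)
      (f : S -> incomplete_tensor K y) (a : incomplete_tensor K y) :
      f s @[s --> F] --> a -> val (f s) @[s --> F] --> (val a : K).
    move=> /cvgrPdist_lt fa; apply/cvgrPdist_lt => e /fa.
    by apply: filterS => s; rewrite valE.
  move=> u x cu ux.
  apply: (@orbit_continuous R (incomplete_tensor K y) K val TT x
    (fun n t => val (TT t (u n))) valE sTT) => [n t t0|t t0].
    by apply: val_cvg; exact: cu.
  by apply: val_cvg; exact: bounded_op_cvg.
Qed.

Theorem corollary6p11 (R : realType) (H : nat -> hilbert R)
    (K : complete_tensor H) (y : cseq H) (y_c0 : is_c0seq y)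
    (T : forall n : nat, R -> bounded_op (H n))
    (T_semigroup : forall n, semigroup (T n))
    (TT : R -> bounded_op (incomplete_tensor K y))
    (TT_tensor : forall t, 0 <= t -> is_tensor_op (fun n => T n t) (TT t))
    (TT_semigroup : semigroup TT)
    (TT_nonzero : nonzero_semigroup TT) :
  ((forall n, weakly_measurable (T n)) -> weakly_measurable TT) /\
  ((forall n, strongly_continuous (T n)) -> strongly_continuous TT).
Proof.
split; first exact: weakly_measurable_tensor.
exact: strongly_continuous_tensor.
Qed.
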